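(* Let $K:\mathcal I\times\mathcal I\to\mathbb{R}$ be a bounded measurable symmetric kernel and $K_s>0$. The dynamics $$\partial_t\theta(x)=\int_{\mathcal I} K(x,y)\sin(\theta(x)-\theta(y))\,\mathrm{d}y-K_s\sin(2\theta(x))$$ are the gradient flow dynamics $\partial_t\theta=-\nabla E(\theta)$ of the energy $$E(\theta)=\frac12\int_{\mathcal I}\!\int_{\mathcal I} K(x,y)\cos(\theta(x)-\theta(y))\,\mathrm{d}x\,\mathrm{d}y-\frac{K_s}{2}\int_{\mathcal I}\cos(2\theta(x))\,\mathrm{d}x$$ with respect to the $L^2$ Riemannian structure on $\Theta$.
   Context: $\mathcal I$ is an index set carrying a finite (Lebesgue) measure $\mathrm{d}x$, e.g. $[0,1]$; $\mathbb{T}=\mathbb{R}/2\pi\mathbb{Z}$. $\Theta$ is the set of measurable functions $\theta:\mathcal I\to\mathbb{T}$ modulo a.e. equality (equivalently, $L^2(\mathcal I;\mathbb{R})$ functions with values identified modulo $2\pi$). All tangent spaces are identified with $L^2(\mathcal I;\mathbb{R})$ with its standard inner product $\langle\cdot,\cdot\rangle$, and $\theta+v$ is defined pointwise modulo $2\pi$ for $v\in L^2(\mathcal I;\mathbb{R})$. The gradient $\nabla E(\theta)\in L^2(\mathcal I;\mathbb{R})$ is defined by $\langle\nabla E(\theta),v\rangle=DE(\theta)[v]$ for all $v\in L^2(\mathcal I;\mathbb{R})$, where $DE(\theta)[v]=\lim_{h\to0}\frac{E(\theta+hv)-E(\theta)}{h}$. *)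

(* Defs.v *)
From HB Require Import structures.
From mathcomp Require Import all_boot all_order all_algebra.
From mathcomp Require Import all_classical all_reals all_analysis.
From mathcomp Require Import measurable_realfun ring.

Set Implicit Arguments.
Unset Strict Implicit.
Unset Printing Implicit Defensive.
Import Order.TTheory GRing.Theory Num.Theory.
Import numFieldNormedType.Exports.

Local Open Scope classical_set_scope.
Local Open Scope ring_scope.
Local Open Scope quotient_scope.

(* Square-integrable functions (not classes): two of them represent the same
   element of L^2(I; R) when they agree mu-almost everywhere. *)
Notation L2 mu := (LfunType mu (lee1n 2)).

Section L2_structure.
Context d (I : measurableType d) (R : realType).
Variable mu : {measure set I -> \bar R}.

Definition L2inner (g v : L2 mu) : R := \int[mu]_x (g x * v x).

Definition L2norm (f : L2 mu) : R := fine 'N[mu]_2%:E[EFin \o f]%E.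

End L2_structure.

(* The configuration space Theta is L^2(I; R) with values identified modulo
   2 pi, that is, measurable maps from I to R / 2 pi Z up to a.e. equality. *)
Section phase_space.
Context d (I : measurableType d) (R : realType).
Variable mu : {measure set I -> \bar R}.

Definition eq_phase (f g : L2 mu) : bool :=
  `[< {ae mu, forall x, exists k : int, f x - g x = k%:~R * (2 * pi)} >].

Let eq_phase_refl : reflexive eq_phase.
Proof.
move=> f; apply/asboolP; apply: filterE => x.
by exists 0; rewrite subrr mul0r.
Qed.

Let eq_phase_sym : symmetric eq_phase.
Proof.
suff sym f g : eq_phase f g -> eq_phase g f.
  by move=> f g; apply/idP/idP; exact: sym.
move=> /asboolP fg; apply/asboolP; apply: filterS fg => x [k fgk].
by exists (- k); rewrite -opprB fgk rmorphN mulNr.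
Qed.

Let eq_phase_trans : transitive eq_phase.
Proof.
move=> g f h /asboolP fg /asboolP gh; apply/asboolP.
apply: filterS2 fg gh => x [k fgk] [l ghl].
by exists (k + l); rewrite rmorphD mulrDl -fgk -ghl addrA subrK.
Qed.

Canonical eq_phase_equiv :=
  EquivRel eq_phase eq_phase_refl eq_phase_sym eq_phase_trans.

Definition Theta : Type := {eq_quot eq_phase}.
HB.instance Definition _ := Choice.on Theta.
HB.instance Definition _ := EqQuotient.on Theta.

Definition translate (theta : Theta) (v : L2 mu) : Theta :=
  \pi_Theta (repr theta + v).

Lemma eq_phase_pi (f : L2 mu) :
  {ae mu, forall x, exists k : int,
    repr (\pi_Theta f) x - f x = k%:~R * (2 * pi)}.
Proof. by apply/asboolP; rewrite -[asbool _]/(eq_phase _ _) -eqmodE reprK. Qed.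

Lemma translate_pi (f v : L2 mu) :
  translate (\pi_Theta f) v = \pi_Theta (f + v).
Proof.
apply/eqmodP/asboolP; apply: filterS (eq_phase_pi f) => x [k fk].
by exists k; rewrite -fk /= opprD addrACA subrr addr0.
Qed.

End phase_space.
Arguments Theta {d I R} mu.

Section gradient_flow.
Context d (I : measurableType d) (R : realType).
Variable mu : {measure set I -> \bar R}.

(* g represents the gradient of E at theta: each directional derivative
   DE(theta)[v] exists and is equal to <g, v>. *)
Definition is_gradient (E : Theta mu -> R) (theta : Theta mu) (g : L2 mu) :=
  forall v : L2 mu,
    (fun h : R => (E (translate theta (h *: v)) - E theta) / h) @ 0^'
      --> L2inner g v.

(* w represents the velocity at time t of a curve in Theta defined for times
   in J: displacements u s from theta t to theta s can be chosen so that
   u s / (s - t) tends to w in L^2 as s tends to t in J; the velocity is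
   one-sided at an endpoint of J. *)
Definition is_velocity (J : interval R) (theta : R -> Theta mu) (t : R)
    (w : L2 mu) :=
  exists2 u : R -> L2 mu,
    forall s, s \in J -> theta s = translate (theta t) (u s) &
    L2norm ((s - t)^-1 *: u s - w) @[s --> within [set` J] t^'] --> (0 : R).

(* d theta / dt = - grad E(theta) on J *)
Definition gradient_flow (E : Theta mu -> R) (J : interval R)
    (theta : R -> Theta mu) :=
  forall t, t \in J ->
    exists2 g : L2 mu, is_gradient E (theta t) g & is_velocity J theta t (- g).

(* d theta / dt = F(theta) on J, with equality almost everywhere on I *)
Definition evolves_by (F : Theta mu -> I -> R) (J : interval R)
    (theta : R -> Theta mu) :=
  forall t, t \in J ->
    exists2 w : L2 mu, {ae mu, forall x, w x = F (theta t) x} &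
      is_velocity J theta t w.

End gradient_flow.

Section oscillators.
Context d (I : measurableType d) (R : realType).
Variable mu : {finite_measure set I -> \bar R}.
Variables (K : I -> I -> R) (Ks : R).

Definition phase_field_fun (f : I -> R) (x : I) : R :=
  \int[mu]_y (K x y * sin (f x - f y)) - Ks * sin (2 * f x).

Definition energy_fun (f : I -> R) : R :=
  2^-1 * (\int[mu]_y \int[mu]_x (K x y * cos (f x - f y)))
  - Ks / 2 * \int[mu]_x cos (2 * f x).

(* By periodicity the choice of the representative of theta does not matter:
   see phase_field_pi and energy_pi. *)
Definition phase_field (theta : Theta mu) (x : I) : R :=
  phase_field_fun (repr theta) x.

Definition energy (theta : Theta mu) : R := energy_fun (repr theta).

End oscillators.

Section well_defined.
Context d (I : measurableType d) (R : realType).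
Variable mu : {finite_measure set I -> \bar R}.
Variables (K : I -> I -> R) (Ks : R).
Hypothesis mK : measurable_fun [set: I * I] (fun z : I * I => K z.1 z.2).

Lemma periodic_intmul (f : R -> R) (T : R) (k : int) (a : R) :
  periodic f T -> f (a + k%:~R * T) = f a.
Proof.
move=> fT; rewrite mulrzl; case: k => n; first by rewrite -pmulrn periodicn.
by rewrite NegzE mulrNz -pmulrn -[in RHS](subrK (T *+ n.+1) a) periodicn.
Qed.

Lemma cos_shift (k : int) (a : R) : cos (a + k%:~R * (2 * pi)) = cos a.
Proof. by rewrite mulr_natl; exact/periodic_intmul/cosD2pi. Qed.

Lemma sin_shift (k : int) (a : R) : sin (a + k%:~R * (2 * pi)) = sin a.
Proof. by rewrite mulr_natl; exact/periodic_intmul/sinD2pi. Qed.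

Lemma measurable_interaction (c : R -> R) (f : I -> R) :
  continuous c -> measurable_fun setT f ->
  measurable_fun [set: I * I] (fun z => K z.1 z.2 * c (f z.1 - f z.2)).
Proof.
move=> cc mf; apply: measurable_funM => //.
apply: (measurableT_comp (continuous_measurable_fun cc)).
by apply: measurable_funB; exact: measurableT_comp.
Qed.

Lemma measurable_Rintegral1 (h : I * I -> R) : measurable_fun setT h ->
  measurable_fun setT (fun y => \int[mu]_x h (x, y)).
Proof.
move=> /measurable_EFinP mh; apply: measurableT_comp => //.
rewrite [X in measurable_fun _ X](_ : _ =
  (fun y => \int[mu]_x ((EFin \o h)^\+ (x, y))) \-
  (fun y => \int[mu]_x ((EFin \o h)^\- (x, y))))%E.
  apply: emeasurable_funB.
  - apply: (@measurable_fun_fubini_tonelli_G _ _ _ _ _ mu ((EFin \o h)^\+)%E) => //.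
    exact: measurable_funepos.
  - apply: (@measurable_fun_fubini_tonelli_G _ _ _ _ _ mu ((EFin \o h)^\-)%E) => //.
    exact: measurable_funeneg.
apply/funext => y; rewrite integralE; congr (_ - _)%E.
- by apply: eq_integral => x _; rewrite !funeposE.
- by apply: eq_integral => x _; rewrite !funenegE.
Qed.

Lemma ae_eq_Rintegral (h1 h2 : I -> R) :
  measurable_fun setT h1 -> measurable_fun setT h2 ->
  {ae mu, forall x, h1 x = h2 x} -> \int[mu]_x h1 x = \int[mu]_x h2 x.
Proof.
move=> m1 m2 h12; congr fine; apply: ae_eq_integral => //.
- exact/measurable_EFinP.
- exact/measurable_EFinP.
- by apply: filterS h12 => x -> _.
Qed.

Lemma phase_field_pi (f : L2 mu) :
  {ae mu, forall x, phase_field K Ks (\pi_(Theta mu) f) x =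
                    phase_field_fun mu K Ks f x}.
Proof.
have fk := eq_phase_pi f; set g : L2 mu := repr _ in fk.
apply: filterS (fk) => x [k xk]; rewrite /phase_field /phase_field_fun -/g.
have gx : g x = f x + k%:~R * (2 * pi) by rewrite -xk addrC subrK.
congr (_ - _ * _); last first.
  by rewrite gx mulrDr mulrA -[2 * k%:~R](intrM _ 2 k) sin_shift.
apply: ae_eq_Rintegral.
- exact: (measurableT_comp
    (measurable_interaction (@continuous_sin R) (measurable_funPT g))
    (pair1_measurable x)).
- exact: (measurableT_comp
    (measurable_interaction (@continuous_sin R) (measurable_funPT f))
    (pair1_measurable x)).
- apply: filterS fk => y [l yl].
  have -> : g x - g y = f x - f y + (k - l)%:~R * (2 * pi).
    by rewrite rmorphB mulrBl -yl -xk; ring.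
  by rewrite sin_shift.
Qed.

Lemma energy_pi (f : L2 mu) :
  energy K Ks (\pi_(Theta mu) f) = energy_fun mu K Ks f.
Proof.
have fk := eq_phase_pi f; set g : L2 mu := repr _ in fk.
rewrite /energy /energy_fun -/g.
have mcos (h : L2 mu) :=
  measurable_interaction (@continuous_cos R) (measurable_funPT h).
congr (_ * _ - _ * _).
  apply: ae_eq_Rintegral.
  - exact: (measurable_Rintegral1 (mcos g)).
  - exact: (measurable_Rintegral1 (mcos f)).
  - apply: filterS (fk) => y [l yl]; apply: ae_eq_Rintegral.
    + exact: (measurableT_comp (mcos g) (pair2_measurable y)).
    + exact: (measurableT_comp (mcos f) (pair2_measurable y)).
    + apply: filterS fk => x [k xk].
      have -> : g x - g y = f x - f y + (k - l)%:~R * (2 * pi).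
        by rewrite rmorphB mulrBl -yl -xk; ring.
      by rewrite cos_shift.
have mcos2 (h : L2 mu) : measurable_fun setT (fun x => cos (2 * h x)).
  apply: (measurableT_comp (continuous_measurable_fun (@continuous_cos R))).
  exact: measurable_funM.
apply: ae_eq_Rintegral; [exact: mcos2|exact: mcos2|].
apply: filterS fk => x [k xk].
have -> : g x = f x + k%:~R * (2 * pi) by rewrite -xk addrC subrK.
by rewrite mulrDr mulrA -[2 * k%:~R](intrM _ 2 k) cos_shift.
Qed.

End well_defined.

(* Main.v *)
(* Along a line f + h v both terms of the energy are integrals, over mu \x mu
   and over mu, of k cos (a + h b) with k bounded and b integrable; the
   h-derivative of the integrand is dominated by |k b|, so one differentiates
   under the integral sign. By Fubini and the symmetry of K, exchanging v(x)
   for v(y) in the double integral of K(x,y) sin(f x - f y) v(x) changes its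
   sign, so the derivative at 0 is the inner product of v with minus the phase
   field, which is bounded and hence lies in L^2. *)
Require Import Defs.
From HB Require Import structures.
From mathcomp Require Import all_boot all_order all_algebra.
From mathcomp Require Import all_classical all_reals all_analysis.
From mathcomp Require Import measurable_realfun ess_sup_inf ring.
Set Implicit Arguments.
Unset Strict Implicit.
Import Order.TTheory GRing.Theory Num.Theory.
Import numFieldNormedType.Exports.

Local Open Scope classical_set_scope.
Local Open Scope ring_scope.

(** * Fubini's theorem for real-valued iterated integrals *)

Section real_fubini.
Context d1 d2 (T1 : measurableType d1) (T2 : measurableType d2) (R : realType).
Variable m1 : {sigma_finite_measure set T1 -> \bar R}.
Variable m2 : {sigma_finite_measure set T2 -> \bar R}.
Implicit Types h : T1 * T2 -> R.

(** Almost every section of an integrable function is integrable, so the [fine] hidden in the real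
    inner integral alters the extended one only on a null set. *)
Lemma Rintegral12_prod h :
  (m1 \x m2)%E.-integrable setT (EFin \o h) ->
  \int[m1]_x \int[m2]_y h (x, y) = \int[(m1 \x m2)%E]_z h z.
Proof.
move=> ih; rewrite [RHS]/Rintegral -integral12_prod_meas1//; congr fine.
apply: ae_eq_integral => //.
- apply/measurable_EFinP; apply: measurableT_comp => //.
  exact: measurable_fubini_F ih.
- exact: measurable_fubini_F ih.
apply: filterS (ae_integrable1 ih) => x ihx _.
by rewrite fineK//; exact: integrable_fin_num.
Qed.

Lemma Rintegral21_prod h :
  (m1 \x m2)%E.-integrable setT (EFin \o h) ->
  \int[m2]_y \int[m1]_x h (x, y) = \int[(m1 \x m2)%E]_z h z.
Proof.
move=> ih; rewrite [RHS]/Rintegral -integral21_prod_meas1//; congr fine.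
apply: ae_eq_integral => //.
- apply/measurable_EFinP; apply: measurableT_comp => //.
  exact: measurable_fubini_G ih.
- exact: measurable_fubini_G ih.
apply: filterS (ae_integrable2 ih) => y ihy _.
by rewrite fineK//; exact: integrable_fin_num.
Qed.

End real_fubini.

(** * Integrability on the product space and by domination *)

Section integrable_prod.
Context d (I : measurableType d) (R : realType).
Variable mu : {finite_measure set I -> \bar R}.
Implicit Types v : I -> R.

(** By Tonelli the double integral of [|v z.1|] is the integral of [|v|] times the mass of [mu],
    which is finite. *)
Lemma integrable_comp_fst v : mu.-integrable setT (EFin \o v) ->
  (mu \x mu)%E.-integrable setT (EFin \o (fun z : I * I => v z.1)).
Proof.
move=> /integrableP[/measurable_EFinP mv voo]; apply/integrable12ltyP => /=.
  by apply/measurable_EFinP; exact: (measurableT_comp mv measurable_fst).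
under eq_integral do rewrite integral_cst//.
rewrite ge0_integralZr//; last exact/measurable_EFinP/measurableT_comp.
apply: lte_mul_pinfty; first exact: integral_ge0.
  by rewrite ge0_fin_numE//; exact: integral_ge0.
by rewrite -ge0_fin_numE//; exact: fin_num_measure.
Qed.

Lemma integrable_comp_snd v : mu.-integrable setT (EFin \o v) ->
  (mu \x mu)%E.-integrable setT (EFin \o (fun z : I * I => v z.2)).
Proof.
move=> /integrableP[/measurable_EFinP mv voo]; apply/integrable21ltyP => /=.
  by apply/measurable_EFinP; exact: (measurableT_comp mv measurable_snd).
under eq_integral do rewrite integral_cst//.
rewrite ge0_integralZr//; last exact/measurable_EFinP/measurableT_comp.
apply: lte_mul_pinfty; first exact: integral_ge0.
  by rewrite ge0_fin_numE//; exact: integral_ge0.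
by rewrite -ge0_fin_numE//; exact: fin_num_measure.
Qed.

End integrable_prod.

Lemma integrable_mull d (T : measurableType d) (R : realType)
    (m : {measure set T -> \bar R}) (c : R) (f : T -> R) :
  m.-integrable setT (EFin \o f) ->
  m.-integrable setT (EFin \o (fun x => c * f x)).
Proof. by move=> ?; exact: (@integrableZl _ _ _ m setT _ c (EFin \o f)). Qed.

Lemma le_integrable_cst_mul d (T : measurableType d) (R : realType)
    (m : {measure set T -> \bar R}) (M : R) (f g : T -> R) :
  measurable_fun setT f -> (forall x, `|f x| <= M * `|g x|) ->
  m.-integrable setT (EFin \o g) -> m.-integrable setT (EFin \o f).
Proof.
move=> mf fg ig.
apply: (@le_integrable _ _ _ m setT _ _ (fun x => M%:E * (g x)%:E)%E) => //.
- exact/measurable_EFinP.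
- move=> x _; rewrite -EFinM !abse_EFin lee_fin normrM.
  by rewrite (le_trans (fg x))// ler_wpM2r// ler_norm.
- exact: integrableZl.
Qed.

(** * Differentiation under the integral sign *)

Section derivative_of_cosine_integral.
Context d (T : measurableType d) (R : realType).
Variable m : {measure set T -> \bar R}.
Variables k a b : T -> R.
Hypothesis ik : forall h : R,
  m.-integrable setT (EFin \o (fun x => k x * cos (a x + h * b x))).
Hypothesis ikb : m.-integrable setT (EFin \o (fun x => k x * b x)).

(** Serves both energy terms: the coupling on the product space with [k] the kernel, and the forcing
    on [mu] with [k = 1]. *)
Lemma cvg_Rintegral_cos :
  h^-1 * (\int[m]_x (k x * cos (a x + h * b x)) - \int[m]_x (k x * cos (a x)))
    @[h --> 0^'] --> \int[m]_x - (k x * sin (a x) * b x).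
Proof.
pose f (h : R) x := k x * cos (a x + h * b x).
have der x (h : R) :
    is_derive h 1 (f ^~ x) (- (k x * sin (a x + h * b x) * b x)).
  have -> : f ^~ x = k x \*: (@cos R \o (cst (a x) + b x \*: id)).
    by apply/funext => u; rewrite /f /= !fctE /= [b x *: _]mulrC.
  have dab : is_derive h 1 (cst (a x) + b x \*: id) (0 + b x *: 1).
    exact: is_deriveD.
  have dcos := is_derive1_comp (is_derive_cos _) dab.
  apply: is_derive_eq.
  rewrite !fctE /= add0r /GRing.scale/= mulr1 mulrA mulrN mulNr.
  by rewrite [b x * h]mulrC.
have d1f h x : partial1of2 f h x = - (k x * sin (a x + h * b x) * b x).
  by rewrite partial1of2E derive_val.
(* Any open interval around 0 would do for [h]; since [|sin| <= 1], the bound [|k x * b x|] does not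
   depend on [h]. *)
have := fun i0 intf derf => @cvg_differentiation_under_integral R _ T m f setT
  measurableT 0 (-1) 1 i0 intf derf (fun x => `|k x * b x|).
have -> : \int[m]_x (partial1of2 f 0 x) = \int[m]_x - (k x * sin (a x) * b x).
  by apply: eq_Rintegral => x _; rewrite d1f mul0r addr0.
have -> : (fun h : R => h^-1 *: (\int[m]_y f (h + 0) y - \int[m]_y f 0 y)) =
  (fun h => h^-1 * (\int[m]_x (k x * cos (a x + h * b x)) -
    \int[m]_x (k x * cos (a x)))).
  apply/funext => h; rewrite addr0; congr (_ * (_ - _)).
  by apply: eq_Rintegral => x _; rewrite /f mul0r addr0.
apply => //.
- by rewrite /= in_itv/= ltrN10 ltr01.
- by move=> h _; exact: ik.
- exact: integrable_norm ikb.
- move=> h x _ _; rewrite d1f normrN !normrM mulrAC ler_piMr ?sin_max //.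
Qed.

End derivative_of_cosine_integral.

(** * Square-integrable functions for a finite measure *)

Section L2.
Context d (I : measurableType d) (R : realType).
Variable mu : {finite_measure set I -> \bar R}.

Lemma L2_integrable (f : L2 mu) : mu.-integrable setT (EFin \o f).
Proof.
apply/Lfun1_integrable; apply: Lfun_subset12; first exact: fin_num_measure.
exact: LfunP.
Qed.

Lemma L2_integrable_mul (f g : L2 mu) :
  mu.-integrable setT (EFin \o (fun x => f x * g x)).
Proof. by apply/Lfun1_integrable/Lfun2_mul_Lfun1; exact: LfunP. Qed.

(** A uniform bound puts [f] in the space of exponent [+oo], which is contained in the one of
    exponent 2 because [mu] is finite. *)
Lemma measurable_bounded_L2 (f : I -> R) (M : R) :
  measurable_fun setT f -> (forall x, `|f x| <= M) ->
  exists g : L2 mu, g =1 f.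
Proof.
move=> mf fM.
have fL : f \in Lfun mu 2%:E.
  apply: (@Lfun_subset _ _ _ mu 2%:E +oo%E);
    rewrite ?lee1n ?leey ?fin_num_measure//.
  rewrite inE; apply/andP; split; rewrite inE//= /finite_norm unlock.
  case: ifPn => // _; apply: (@le_lt_trans _ _ M%:E); last exact: ltry.
  by apply/ess_supP/aeW => x /=; rewrite lee_fin.
by exists (Lfun_Sub (lee1n 2) fL).
Qed.

Lemma ae_eq_L2inner (g1 g2 v : L2 mu) :
  {ae mu, forall x, g1 x = g2 x} -> L2inner g1 v = L2inner g2 v.
Proof.
move=> g12; apply: ae_eq_Rintegral.
- exact: measurable_funM.
- exact: measurable_funM.
- by apply: filterS g12 => x ->.
Qed.

(** Testing against [g1 - g2] makes the integral of its square vanish. This gives uniqueness of the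
    gradient. *)
Lemma L2inner_inj (g1 g2 : L2 mu) :
  (forall v, L2inner g1 v = L2inner g2 v) -> {ae mu, forall x, g1 x = g2 x}.
Proof.
move=> /(_ (g1 - g2)) g12.
have i0 : \int[mu]_x ((g1 - g2) x * (g1 - g2) x) = 0.
  transitivity (L2inner g1 (g1 - g2) - L2inner g2 (g1 - g2)); last first.
    by rewrite g12 subrr.
  rewrite /L2inner -RintegralB//; [|exact: L2_integrable_mul..].
  by apply: eq_Rintegral => x _; rewrite -mulrBl.
have i12 := L2_integrable_mul (g1 - g2) (g1 - g2).
(* The integrand is a nonnegative square with finite integral, so the real equality [i0] lifts to
   the extended integral of the absolute value. *)
have abs0 : (\int[mu]_x `|((g1 - g2) x * (g1 - g2) x)%:E| = 0)%E.
  under eq_integral do rewrite gee0_abs ?lee_fin -?expr2 ?sqr_ge0//.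
  rewrite -[LHS]fineK; last exact: integrable_fin_num i12.
  by congr EFin.
have /(ae_eq_integral_abs mu measurableT (measurable_int _ i12)).1 := abs0.
apply: filterS => x /(_ Logic.I) [] /eqP.
by rewrite mulf_eq0 orbb subr_eq0 => /eqP.
Qed.

End L2.

(** * The phase field and the derivative of the energy *)

Section oscillators.
Context d (I : measurableType d) (R : realType).
Variable mu : {finite_measure set I -> \bar R}.
Variables (K : I -> I -> R) (Ks M : R).
Hypothesis mK : measurable_fun [set: I * I] (fun z : I * I => K z.1 z.2).
Hypothesis K_le : forall x y, `|K x y| <= M.
Hypothesis K_sym : forall x y, K x y = K y x.

Lemma integrable_interaction (c : R -> R) (f : I -> R) (g : I * I -> R) :
  continuous c -> (forall x, `|c x| <= 1) -> measurable_fun setT f ->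
  (mu \x mu)%E.-integrable setT (EFin \o g) ->
  (mu \x mu)%E.-integrable setT
    (EFin \o (fun z => K z.1 z.2 * c (f z.1 - f z.2) * g z)).
Proof.
move=> cc c1 mf ig; apply: (@le_integrable_cst_mul _ _ _ _ M _ g) => //.
  apply: measurable_funM; first exact: (measurable_interaction mK cc mf).
  by apply/measurable_EFinP; exact: (measurable_int _ ig).
by move=> z; rewrite !normrM ler_wpM2r// -[leRHS]mulr1 ler_pM.
Qed.

Lemma integrable_coupling (f : L2 mu) (x : I) :
  mu.-integrable setT (EFin \o (fun y => K x y * sin (f x - f y))).
Proof.
apply: (@le_integrable_cst_mul _ _ _ _ M _ (cst 1)) => //.
- exact: (measurableT_comp
    (measurable_interaction mK (@continuous_sin R) (measurable_funPT f))
    (pair1_measurable x)).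
- by move=> y; rewrite normrM normr1 ler_pM// sin_max.
- exact: finite_measure_integrable_cst.
Qed.

Lemma measurable_coupling (f : L2 mu) :
  measurable_fun setT (fun x => \int[mu]_y (K x y * sin (f x - f y))).
Proof.
(* The coordinates are swapped because [measurable_Rintegral1] integrates out the first one, while
   the coupling integrates out the second argument of [K]. *)
apply: (@measurable_Rintegral1 _ _ _ mu
  (fun z => K z.2 z.1 * sin (f z.2 - f z.1))).
exact: (measurableT_comp (measurable_interaction mK (@continuous_sin R)
  (measurable_funPT f)) (@measurable_swap _ _ I I)).
Qed.

Lemma coupling_bounded (f : L2 mu) (x : I) :
  `|\int[mu]_y (K x y * sin (f x - f y))| <= M * fine (mu setT).
Proof.
rewrite (le_trans (le_normr_Rintegral _ (integrable_coupling f x)))//.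
rewrite -(@Rintegral_cst _ _ _ mu setT)//; apply: le_Rintegral => //.
- exact: integrable_norm (integrable_coupling f x).
- exact: finite_measure_integrable_cst.
- by move=> y _; rewrite normrM -[leRHS]mulr1 ler_pM// sin_max.
Qed.

Lemma measurable_sin2 (f : L2 mu) :
  measurable_fun setT (fun x => sin (2 * f x)).
Proof.
apply: (measurableT_comp (continuous_measurable_fun (@continuous_sin R))).
exact: measurable_funM.
Qed.

Lemma phase_field_L2 (f : L2 mu) :
  exists w : L2 mu, w =1 phase_field_fun mu K Ks f.
Proof.
apply: (@measurable_bounded_L2 _ _ _ _ _ (M * fine (mu setT) + `|Ks|)).
  apply: measurable_funB; first exact: measurable_coupling.
  by apply: measurable_funM => //; exact: measurable_sin2.
move=> x; rewrite (le_trans (ler_normB _ _))// lerD ?coupling_bounded//.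
by rewrite normrM ler_piMr// sin_max.
Qed.

Lemma integrable_coupling_mul (f v : L2 mu) : mu.-integrable setT
  (EFin \o (fun x => (\int[mu]_y (K x y * sin (f x - f y))) * v x)).
Proof.
apply: (@le_integrable_cst_mul _ _ _ _ (M * fine (mu setT)) _ v).
- by apply: measurable_funM => //; exact: measurable_coupling.
- by move=> x; rewrite normrM ler_wpM2r// coupling_bounded.
- exact: L2_integrable.
Qed.

(** [K] is symmetric and [sin] is odd, so [S] is antisymmetric and the two halves of the integral
    contribute equally. The resulting 2 cancels the 1/2 of the energy. *)
Lemma integral_sin_interaction (f v : L2 mu) :
  \int[(mu \x mu)%E]_z - (K z.1 z.2 * sin (f z.1 - f z.2) * (v z.1 - v z.2)) =
  - 2 * \int[mu]_x ((\int[mu]_y (K x y * sin (f x - f y))) * v x).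
Proof.
pose S z := K z.1 z.2 * sin (f z.1 - f z.2).
have i1 : (mu \x mu)%E.-integrable setT (EFin \o (fun z => S z * v z.1)).
  apply: integrable_interaction (@continuous_sin R) (@sin_max R) _ _ => //.
  exact/integrable_comp_fst/L2_integrable.
have i2 : (mu \x mu)%E.-integrable setT (EFin \o (fun z => S z * v z.2)).
  apply: integrable_interaction (@continuous_sin R) (@sin_max R) _ _ => //.
  exact/integrable_comp_snd/L2_integrable.
transitivity (\int[(mu \x mu)%E]_z (S z * v z.2) -
              \int[(mu \x mu)%E]_z (S z * v z.1)).
  rewrite -RintegralB//; apply: eq_Rintegral => z _.
  by rewrite -mulrBr -mulrN opprB.
(* Each term is integrated first in the variable on which [v] does not depend, so that [v] factors
   out of the inner integral. *)
rewrite -(Rintegral21_prod i2) -(Rintegral12_prod i1).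
have -> : \int[mu]_x \int[mu]_y (S (x, y) * v (x, y).1) =
    \int[mu]_x ((\int[mu]_y (K x y * sin (f x - f y))) * v x).
  apply: eq_Rintegral => x _; rewrite -RintegralZr//.
  exact: integrable_coupling.
have -> : \int[mu]_y \int[mu]_x (S (x, y) * v (x, y).2) =
    \int[mu]_x (- 1 * ((\int[mu]_y (K x y * sin (f x - f y))) * v x)).
  apply: eq_Rintegral => x _; rewrite mulN1r -mulrN -RintegralZr//.
    apply: eq_Rintegral => y _.
    by rewrite /S /= K_sym -opprB sinN !mulrN mulNr.
  exact: integrable_coupling.
rewrite RintegralZl//; first by ring.
exact: integrable_coupling_mul.
Qed.

(** The factor [1] and the grouping [h * (2 * v x)] match the form required by
    [cvg_Rintegral_cos]. *)
Lemma integrable_cos2 (f v : L2 mu) (h : R) : mu.-integrable setT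
  (EFin \o (fun x => 1 * cos (2 * f x + h * (2 * v x)))).
Proof.
apply: (@le_integrable_cst_mul _ _ _ _ 1 _ (cst 1)).
- apply: measurable_funM => //.
  apply: (measurableT_comp (continuous_measurable_fun (@continuous_cos R))).
  by apply: measurable_funD; do ?[apply: measurable_funM => //].
- by move=> x; rewrite mul1r normr1 mulr1 cos_max.
- exact: finite_measure_integrable_cst.
Qed.

Lemma integrable_sin2_mul (f v : L2 mu) :
  mu.-integrable setT (EFin \o (fun x => sin (2 * f x) * v x)).
Proof.
apply: (@le_integrable_cst_mul _ _ _ _ 1 _ v).
- by apply: measurable_funM => //; exact: measurable_sin2.
- by move=> x; rewrite normrM ler_wpM2r// sin_max.
- exact: L2_integrable.
Qed.

Lemma cvg_energy_quotient (f v w : L2 mu) : w =1 phase_field_fun mu K Ks f ->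
  (fun h : R => (energy_fun mu K Ks (f + h *: v) - energy_fun mu K Ks f) / h)
    @ 0^' --> L2inner (- w) v.
Proof.
move=> wE; have oppE x : (- w) x = - w x by [].
have shiftE h x : (f + h *: v) x = f x + h * v x by [].
have intc (h : R) : (mu \x mu)%E.-integrable setT (EFin \o (fun z =>
    K z.1 z.2 * cos ((f z.1 - f z.2) + h * (v z.1 - v z.2)))).
  have i1 : (mu \x mu)%E.-integrable setT (EFin \o (fun z : I * I => 1 : R)).
    exact/(@integrable_comp_fst _ _ _ _ (cst 1))/finite_measure_integrable_cst.
  (* The phase [f + h *: v] is again in L2, so this is its own cosine interaction with [g = 1],
     after regrouping the argument. *)
  apply: eq_integrable (@integrable_interaction cos (f + h *: v) _
    (@continuous_cos R) (@cos_max R) (measurable_funPT _) i1) => // z _.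
  rewrite /comp; congr (_%:E); rewrite mulr1; congr (_ * cos _).
  by rewrite !shiftE; ring.
have energyE h : energy_fun mu K Ks (f + h *: v) =
    2^-1 * (\int[(mu \x mu)%E]_z
      (K z.1 z.2 * cos ((f z.1 - f z.2) + h * (v z.1 - v z.2)))) -
    Ks / 2 * \int[mu]_x (1 * cos (2 * f x + h * (2 * v x))).
  congr (_ * _ - _ * _).
    apply: etrans (Rintegral21_prod (intc h)).
    apply: eq_Rintegral => y _; apply: eq_Rintegral => x _.
    by congr (_ * cos _); rewrite !shiftE; ring.
  apply: eq_Rintegral => x _.
  by rewrite mul1r; congr cos; rewrite !shiftE; ring.
have energy0 : energy_fun mu K Ks f =
    2^-1 * (\int[(mu \x mu)%E]_z (K z.1 z.2 * cos (f z.1 - f z.2))) -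
    Ks / 2 * \int[mu]_x (1 * cos (2 * f x)).
  have := energyE 0; rewrite scale0r addr0 => ->; congr (_ * _ - _ * _).
    by apply: eq_Rintegral => z _; rewrite mul0r addr0.
  by apply: eq_Rintegral => x _; rewrite mul0r addr0.
have ikb : (mu \x mu)%E.-integrable setT
    (EFin \o (fun z => K z.1 z.2 * (v z.1 - v z.2))).
  apply: (@le_integrable_cst_mul _ _ _ _ M _ (fun z => v z.1 - v z.2)).
  - apply: measurable_funM; first exact: mK.
    apply: measurable_funB.
      exact: (measurableT_comp (measurable_funPT v) measurable_fst).
    exact: (measurableT_comp (measurable_funPT v) measurable_snd).
  - by move=> z; rewrite normrM ler_wpM2r.
  - rewrite (_ : EFin \o _ = (EFin \o (fun z : I * I => v z.1)) \-
      (EFin \o (fun z : I * I => v z.2)))%E; last by [].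
    apply: integrableB => //.
      exact/integrable_comp_fst/L2_integrable.
    exact/integrable_comp_snd/L2_integrable.
have cK := @cvg_Rintegral_cos _ _ _ _ _ _ _ intc ikb.
have i2v : mu.-integrable setT (EFin \o (fun x => 1 * (2 * v x))).
  exact: (integrable_mull 1 (integrable_mull 2 (L2_integrable v))).
have c2 := @cvg_Rintegral_cos _ _ _ _ _ _ _ (integrable_cos2 f v) i2v.
rewrite integral_sin_interaction in cK.
(* The limits of the two terms add up to the inner product: the 2 from antisymmetry cancels 1/2, and
   the 2 from differentiating [cos (2 * f x)] cancels the one in [Ks / 2]. *)
have -> : L2inner (- w) v =
    2^-1 * (- 2 * \int[mu]_x ((\int[mu]_y (K x y * sin (f x - f y))) * v x)) -
    Ks / 2 * \int[mu]_x - (1 * sin (2 * f x) * (2 * v x)).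
  rewrite mulrA mulrN mulVf// mulN1r.
  have -> : \int[mu]_x - (1 * sin (2 * f x) * (2 * v x)) =
      - 2 * \int[mu]_x (sin (2 * f x) * v x).
    rewrite -RintegralZl//; last exact: integrable_sin2_mul.
    by apply: eq_Rintegral => x _; ring.
  rewrite mulNr mulrN opprK mulrA divfK//.
  rewrite -(RintegralZl _ _ (integrable_sin2_mul f v))//.
  rewrite addrC -RintegralB//.
  - by apply: eq_Rintegral => x _; rewrite oppE wE /phase_field_fun; ring.
  - exact: integrable_mull (integrable_sin2_mul f v).
  - exact: integrable_coupling_mul.
rewrite [X in X @ _](_ : _ = (fun h =>
    2^-1 * (h^-1 * (\int[(mu \x mu)%E]_z
        (K z.1 z.2 * cos (f z.1 - f z.2 + h * (v z.1 - v z.2))) -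
      \int[(mu \x mu)%E]_z (K z.1 z.2 * cos (f z.1 - f z.2)))) -
    Ks / 2 * (h^-1 * (\int[mu]_x (1 * cos (2 * f x + h * (2 * v x))) -
      \int[mu]_x (1 * cos (2 * f x)))))); last first.
  by apply/funext => h; rewrite energyE energy0; ring.
by apply: cvgB; apply: cvgM => //; exact: cvg_cst.
Qed.

End oscillators.

(** * Identification of the gradient and of the two flows *)

Unset Implicit Arguments.

Theorem corollary3p2 (R : realType) (d : measure_display)
    (I : measurableType d) (mu : {finite_measure set I -> \bar R})
    (K : I -> I -> R) (Ks : R)
    (K_measurable : measurable_fun [set: I * I] (fun z : I * I => K z.1 z.2))
    (K_bounded : exists M : R, forall x y : I, `|K x y| <= M)
    (K_symmetric : forall x y : I, K x y = K y x)
    (Ks_gt0 : 0 < Ks) :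
  (* the gradient of the energy exists everywhere on Theta, and
     - grad E is the right-hand side of the dynamics *)
  (forall theta : Theta mu,
     (exists g : L2 mu, is_gradient (energy K Ks) theta g) /\
     (forall g : L2 mu, is_gradient (energy K Ks) theta g <->
        {ae mu, forall x, - g x = phase_field K Ks theta x})) /\
  (* the dynamics is the gradient flow of the energy *)
  (forall (J : interval R) (theta : R -> Theta mu),
     evolves_by (phase_field K Ks) J theta <->
     gradient_flow (energy K Ks) J theta).
Proof.
have [M K_le] := K_bounded.
have grad theta : exists2 w : L2 mu, w =1 phase_field K Ks theta &
    is_gradient (energy K Ks) theta (- w).
  have [w wE] := phase_field_L2 Ks K_measurable K_le (repr theta).
  exists w => // v.
  (* The translate is the class of [repr theta + h *: v], and the energy may be computed on that
     representative. *)
  under eq_fun do rewrite /translate energy_pi//.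
  exact: (cvg_energy_quotient K_measurable K_le K_symmetric wE).
(* Limits are unique, so any two gradients have the same inner products and agree almost everywhere;
   conversely the inner product sees only the almost-everywhere class. *)
have gradP theta (g : L2 mu) : is_gradient (energy K Ks) theta g <->
    {ae mu, forall x, - g x = phase_field K Ks theta x}.
  have [w wE gradw] := grad theta.
  have oppE x : (- w) x = - w x by [].
  split=> [gradg|gE v].
    have gw : {ae mu, forall x, g x = (- w) x}.
      apply: L2inner_inj => v.
      exact: (cvg_unique _ (gradg v) (gradw v)).
    by apply: filterS gw => x ->; rewrite -wE opprK.
  rewrite (@ae_eq_L2inner _ _ _ mu g (- w) v); first exact: gradw.
  by apply: filterS gE => x; rewrite -wE oppE => <-; rewrite opprK.
split=> [theta|J theta].
  by split=> //; have [w _ gradw] := grad theta; exists (- w).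
(* At each time the two equations prescribe the same velocity, under the correspondence
   [g = - w]. *)
split=> flow t /flow [].
  move=> w wE wv; exists (- w); last by rewrite opprK.
  by apply/gradP; apply: filterS wE => x <-; rewrite /= opprK.
by move=> g /gradP gE gv; exists (- g).
Qed.
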